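(* Let $n\ge 2$, $A\in\mathbb{R}^{n\times n}$, $B_1,B_2\in\mathbb{R}^{n\times 1}$, $C_1\in\mathbb{R}^{1\times n}$, and consider the system $\dot x=Ax+B_1w+B_2u$, $z=C_1x$, with $C_1B_2\neq 0$ and $R:=C_1B_1+B_1^TC_1^T>0$. Let $Q=I-B_2(C_1B_2)^{-1}C_1$ and $A_q=QA$. Suppose that the pair $(A,B_2)$ is controllable and that $A_q$ has $n$ distinct eigenvalues $\lambda_1,\dots,\lambda_n$, none unstable, ordered so that $\operatorname{Re}\lambda_1\le\cdots\le\operatorname{Re}\lambda_{n-1}<0$ and $\lambda_n=0$. Let $\gamma=-\operatorname{Re}\lambda_{n-1}$. Then: (1) For every $\epsilon$ with $0<\epsilon<\gamma$, the closed-loop system $\dot x=(A+B_2K)x+B_1w$, $z=C_1x$ with $K=-(C_1B_2)^{-1}(C_1A+\epsilon C_1)$ is SNI with degree of stability $\epsilon$. (2) Suppose $n\ge 3$. If the Lyapunov conditions at level $\epsilon_0$ (defined in the context) are satisfied for some $\epsilon_0$ with $-\operatorname{Re}\lambda_{n-1}<\epsilon_0<-\operatorname{Re}\lambda_{n-2}$, then for every $\epsilon$ with $-\operatorname{Re}\lambda_{n-1}<\epsilon<-\operatorname{Re}\lambda_{n-2}$ the Lyapunov conditions at level $\epsilon$ are satisfied and the closed-loop system formed with the associated feedback matrix $K$ at level $\epsilon$ (defined in the context) is SNI with degree of stability $\epsilon$.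
   Context: SNI: a square real-rational transfer function matrix $G(s)$ is strictly negative imaginary (SNI) if (i) $G(s)$ has no poles in $\operatorname{Re}[s]\ge 0$, and (ii) $j(G(j\omega)-G(j\omega)^* )>0$ for all $\omega>0$ such that $j\omega$ is not a pole of $G$. A state space system is SNI if its transfer function is; for the closed-loop system this is $G_{cl}(s)=C_1(sI-A-B_2K)^{-1}B_1$. Degree of stability: the closed-loop system has degree of stability $\epsilon$ if all eigenvalues of $A+B_2K$ have real part at most $-\epsilon$. Unstable eigenvalue: an eigenvalue with strictly positive real part. Schur decomposition at level $\epsilon>0$: put $A_r=Q(A+\epsilon I)=A_q+\epsilon Q$. Let $U$ be a real orthogonal matrix (depending on $\epsilon$) from an ordered real Schur decomposition of $A_r$, such that $$U^TA_rU=\begin{bmatrix}\tilde A_{11}&\tilde A_{12}\\0&\tilde A_{22}\end{bmatrix},$$ where $\tilde A_{11}$ has all its eigenvalues in the closed left half plane and all eigenvalues of $\tilde A_{22}$ have strictly positive real part. Partition conformably $$U^TB_1=\begin{bmatrix}\tilde B_{11}\\\tilde B_{22}\end{bmatrix},\qquad U^T\big(B_2(C_1B_2)^{-1}-B_1R^{-1}\big)=\begin{bmatrix}\tilde C_{11}\\\tilde C_{22}\end{bmatrix}.$$ Lyapunov conditions at level $\epsilon$: there exist real symmetric $T\ge 0$ and $S\ge 0$ such that $$-\tilde A_{22}T-T\tilde A_{22}^T+\tilde C_{22}R\tilde C_{22}^T=0,\qquad -\tilde A_{22}S-S\tilde A_{22}^T+\tilde B_{22}R^{-1}\tilde B_{22}^T=0,\qquad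 T-S>0 .$$ Associated feedback matrix at level $\epsilon$: given such $T,S$, $$K=(C_1B_2)^{-1}\big(B_1^TP-C_1A-\epsilon C_1-R(B_2^TC_1^T)^{-1}B_2^TP\big),\qquad P=U\begin{bmatrix}0&0\\0&(T-S)^{-1}\end{bmatrix}U^T .$$ *)

(* Defs.v *)
From HB Require Import structures.
From mathcomp Require Import all_boot all_order all_algebra.
From mathcomp Require Import complex.
From mathcomp Require Import boolp classical_sets reals topology normedtype derive.

Set Implicit Arguments.
Unset Strict Implicit.
Unset Printing Implicit Defensive.

Import Order.TTheory GRing.Theory Num.Theory.
Import numFieldNormedType.Exports.

Local Open Scope ring_scope.
Local Open Scope complex_scope.

Definition cplx_eigenvalue (R : rcfType) (n : nat) (M : 'M[R]_n) (z : R[i]) : Prop :=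
  eigenvalue (map_mx (real_complex R) M) z.

Definition herm_posdef (R : rcfType) (m : nat) (M : 'M[R[i]]_m) : Prop :=
  M = map_mx conjc M^T /\
  forall v : 'cV[R[i]]_m, v != 0 -> 0 < (map_mx conjc v^T *m M *m v) 0 0.

Definition sym_posdef (R : realFieldType) (m : nat) (M : 'M[R]_m) : Prop :=
  M^T = M /\ forall v : 'cV[R]_m, v != 0 -> 0 < (v^T *m M *m v) 0 0.

Definition sym_possemidef (R : realFieldType) (m : nat) (M : 'M[R]_m) : Prop :=
  M^T = M /\ forall v : 'cV[R]_m, 0 <= (v^T *m M *m v) 0 0.

(* Real-rational functions are elements of [{fraction {poly R}}].  Poles and
   values are read off the reduced fraction, so common factors of numerator and
   denominator are cancelled first. *)
Definition rf_num (R : rcfType) (f : {fraction {poly R}}) : {poly R} :=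
  \n_(repr f) %/ gcdp \n_(repr f) \d_(repr f).

Definition rf_den (R : rcfType) (f : {fraction {poly R}}) : {poly R} :=
  \d_(repr f) %/ gcdp \n_(repr f) \d_(repr f).

Definition cplx_horner (R : rcfType) (p : {poly R}) (s : R[i]) : R[i] :=
  (map_poly (real_complex R) p).[s].

Definition rf_pole (R : rcfType) (f : {fraction {poly R}}) (s : R[i]) : Prop :=
  cplx_horner (rf_den f) s = 0.

(* Meaningful only when [s] is not a pole of [f]. *)
Definition rf_eval (R : rcfType) (f : {fraction {poly R}}) (s : R[i]) : R[i] :=
  cplx_horner (rf_num f) s / cplx_horner (rf_den f) s.

Definition tf_pole (R : rcfType) (m : nat) (G : 'M[{fraction {poly R}}]_m)
    (s : R[i]) : Prop :=
  exists i j, rf_pole (G i j) s.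

Definition tf_eval (R : rcfType) (m : nat) (G : 'M[{fraction {poly R}}]_m)
    (s : R[i]) : 'M[R[i]]_m :=
  map_mx (fun f => rf_eval f s) G.

Definition SNI (R : rcfType) (m : nat) (G : 'M[{fraction {poly R}}]_m) : Prop :=
  (forall s : R[i], tf_pole G s -> ~ (0 <= complex.Re s)) /\
  (forall w : R, 0 < w -> ~ tf_pole G (w *i) ->
    herm_posdef ('i *: (tf_eval G (w *i) - map_mx conjc (tf_eval G (w *i))^T))).

Definition rf_const (R : rcfType) (a : R) : {fraction {poly R}} :=
  FracField.tofrac a%:P.

(* C (s I - A)^-1 B, computed over the field of rational functions in s. *)
Definition transfer (R : rcfType) (n m : nat)
    (A : 'M[R]_n) (B : 'M[R]_(n, m)) (C : 'M[R]_(m, n)) :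
    'M[{fraction {poly R}}]_m :=
  map_mx (@rf_const R) C
    *m invmx ((FracField.tofrac 'X)%:M - map_mx (@rf_const R) A)
    *m map_mx (@rf_const R) B.

Definition has_degree_of_stability (R : rcfType) (n : nat) (M : 'M[R]_n) (e : R)
    : Prop :=
  forall z : R[i], cplx_eigenvalue M z -> complex.Re z <= - e.

(* Every state can be steered to every other one in finite time by some input.
   Derivatives are taken entrywise; for a time-invariant linear system,
   continuous inputs on the whole line steer as much as piecewise continuous
   ones on [0, T]. *)
Definition controllable (R : realType) (n m : nat)
    (A : 'M[R]_n) (B : 'M[R]_(n, m)) : Prop :=
  forall x0 x1 : 'cV[R]_n,
  exists (T : R) (u : R -> 'cV[R]_m) (x : R -> 'cV[R]_n),
    [/\ 0 < T,
        forall k : 'I_m, continuous (fun t : R => u t k 0),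
        x 0 = x0,
        x T = x1 &
        forall (t : R) (k : 'I_n),
          is_derive t (1 : R) (fun s : R => x s k 0)
            ((A *m x t + B *m u t) k 0)].

Definition Rmx (R : rcfType) (n : nat) (B1 : 'cV[R]_n) (C1 : 'rV[R]_n) : 'M[R]_1 :=
  C1 *m B1 + B1^T *m C1^T.

Definition Qmx (R : rcfType) (n : nat) (B2 : 'cV[R]_n) (C1 : 'rV[R]_n) : 'M[R]_n :=
  1%:M - B2 *m invmx (C1 *m B2) *m C1.

Definition Aqmx (R : rcfType) (n : nat) (A : 'M[R]_n) (B2 : 'cV[R]_n)
    (C1 : 'rV[R]_n) : 'M[R]_n :=
  Qmx B2 C1 *m A.

Definition Armx (R : rcfType) (n : nat) (A : 'M[R]_n) (B2 : 'cV[R]_n)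
    (C1 : 'rV[R]_n) (e : R) : 'M[R]_n :=
  Qmx B2 C1 *m (A + e%:M).

Definition closed_loop_SNI_with_degree (R : rcfType) (n : nat) (A : 'M[R]_n)
    (B1 B2 : 'cV[R]_n) (C1 : 'rV[R]_n) (K : 'rV[R]_n) (e : R) : Prop :=
  SNI (transfer (A + B2 *m K) B1 C1) /\ has_degree_of_stability (A + B2 *m K) e.

(* Block upper triangular with diagonal blocks of size 1, or of size 2 without
   real eigenvalues.  The second condition makes blocks of size 3 impossible. *)
Definition real_schur_form (R : rcfType) (N : nat) (M : 'M[R]_N) : Prop :=
  [/\ forall i j : 'I_N, (j.+1 < i)%N -> M i j = 0,
      forall i j k : 'I_N, j = i.+1 :> nat -> k = j.+1 :> nat ->
        M j i = 0 \/ M k j = 0 &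
      forall i j : 'I_N, j = i.+1 :> nat -> M j i != 0 ->
        let b (r : 'I_2) := if r == 0 then i else j in
        forall a : R, ~~ eigenvalue (mxsub b b M) a].

(* The square matrix [U] has its columns indexed by ['I_(n1 + n2)], so that
   [U^T *m M *m U] comes with its block decomposition; [n1 + n2] equals [n]. *)
Definition ordered_schur (R : rcfType) (n n1 n2 : nat) (M : 'M[R]_n)
    (U : 'M[R]_(n, n1 + n2)) : Prop :=
  [/\ (n1 + n2)%N = n,
      U^T *m U = 1%:M /\ U *m U^T = 1%:M,
      real_schur_form (U^T *m M *m U),
      dlsubmx (U^T *m M *m U) = 0 &
      (forall z, cplx_eigenvalue (ulsubmx (U^T *m M *m U)) z -> complex.Re z <= 0) /\
      (forall z, cplx_eigenvalue (drsubmx (U^T *m M *m U)) z -> 0 < complex.Re z)].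

Definition A22 (R : rcfType) (n n1 n2 : nat) (A : 'M[R]_n) (B2 : 'cV[R]_n)
    (C1 : 'rV[R]_n) (e : R) (U : 'M[R]_(n, n1 + n2)) : 'M[R]_n2 :=
  drsubmx (U^T *m Armx A B2 C1 e *m U).

Definition B22 (R : rcfType) (n n1 n2 : nat) (B1 : 'cV[R]_n)
    (U : 'M[R]_(n, n1 + n2)) : 'cV[R]_n2 :=
  dsubmx (U^T *m B1).

Definition C22 (R : rcfType) (n n1 n2 : nat) (B1 B2 : 'cV[R]_n)
    (C1 : 'rV[R]_n) (U : 'M[R]_(n, n1 + n2)) : 'cV[R]_n2 :=
  dsubmx (U^T *m (B2 *m invmx (C1 *m B2) - B1 *m invmx (Rmx B1 C1))).

Definition lyapunov_solution (R : rcfType) (n n1 n2 : nat) (A : 'M[R]_n)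
    (B1 B2 : 'cV[R]_n) (C1 : 'rV[R]_n) (e : R) (U : 'M[R]_(n, n1 + n2))
    (T S : 'M[R]_n2) : Prop :=
  let At := A22 A B2 C1 e U in
  let Bt := B22 B1 U in
  let Ct := C22 B1 B2 C1 U in
  let Rm := Rmx B1 C1 in
  [/\ sym_possemidef T,
      sym_possemidef S,
      - (At *m T) - T *m At^T + Ct *m Rm *m Ct^T = 0,
      - (At *m S) - S *m At^T + Bt *m invmx Rm *m Bt^T = 0 &
      sym_posdef (T - S)].

Definition lyapunov_conditions (R : rcfType) (n n1 n2 : nat) (A : 'M[R]_n)
    (B1 B2 : 'cV[R]_n) (C1 : 'rV[R]_n) (e : R) (U : 'M[R]_(n, n1 + n2)) : Prop :=
  exists T S : 'M[R]_n2, lyapunov_solution A B1 B2 C1 e U T S.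

Definition Pmx (R : rcfType) (n n1 n2 : nat) (U : 'M[R]_(n, n1 + n2))
    (T S : 'M[R]_n2) : 'M[R]_n :=
  U *m block_mx 0 0 0 (invmx (T - S)) *m U^T.

Definition feedback1 (R : rcfType) (n : nat) (A : 'M[R]_n) (B2 : 'cV[R]_n)
    (C1 : 'rV[R]_n) (e : R) : 'rV[R]_n :=
  - (invmx (C1 *m B2) *m (C1 *m A + e *: C1)).

Definition feedback2 (R : rcfType) (n : nat) (A : 'M[R]_n) (B1 B2 : 'cV[R]_n)
    (C1 : 'rV[R]_n) (e : R) (P : 'M[R]_n) : 'rV[R]_n :=
  invmx (C1 *m B2) *m
    (B1^T *m P - C1 *m A - e *: C1
     - Rmx B1 C1 *m invmx (B2^T *m C1^T) *m B2^T *m P).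

(* Main.v *)
Require Import Defs.
From HB Require Import structures.
From mathcomp Require Import all_boot all_order all_algebra.
From mathcomp Require Import complex.
From mathcomp Require Import reals.
From mathcomp Require Import ring lra.
Set Implicit Arguments.
Unset Strict Implicit.
Unset Printing Implicit Defensive.
Import Order.TTheory GRing.Theory Num.Theory.
Local Open Scope ring_scope.
Local Open Scope complex_scope.

(* Both feedback laws turn [A] into [Armx e - e I] plus a rank-one term.  Writing
   [beta = C1 B2], [rho = C1 B1 = R/2], the row [C1] satisfies [C1 Armx e = 0],
   and the eigenvalues of [Armx e] are 0 and the [lam i + e] with [i < n].

   In part (1) the rank-one term vanishes, [C1] is a left eigenvector of the
   closed loop and the transfer function is [rho / (s + e)].

   In part (2) exactly one eigenvalue of [Armx e] is unstable, so the unstable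
   Schur block is the 1x1 matrix [a = lam_(n-1) + e], and [u], the last column of
   [U] transposed, is a left eigenvector.  With [x = u B2 / beta] and
   [y = u B1 / (2 rho)], the Lyapunov equations give
   [a (T - S) = rho x (x - 2 y)], so the Lyapunov conditions say that the
   quadratic form [x (x - 2 y)] in [u] is positive.  Adding to [u] a suitable
   multiple of [C1] gives a left eigenvector of [A_q] for [lam_(n-1)], and
   multiplies the form by [a / lam_(n-1) < 0].  Such eigenvectors do not depend on [e]
   up to scaling, hence neither does the sign of the form.  Finally [C1] and [u]
   span a left invariant plane of the closed loop, on which
   [G(s) = rho (s + e + nu) / ((s + e) (s + e + mu))] with
   [mu = a x / (x - 2 y) > 0] and [nu = a (x - 2 y) / x > 0]. *)

(** * Matrices with distinct eigenvalues *)

(** Eigenspaces of distinct eigenvalues form a direct sum; [n] of them, each of rank at least 1, fit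
    in dimension [n] only if all are lines, so one nonzero row from each gives a basis. *)
Lemma eigenbasis (F : fieldType) (n : nat) (M : 'M[F]_n) (l : 'I_n -> F) :
  injective l -> (forall i, eigenvalue M (l i)) ->
  exists2 V : 'M[F]_n, V \in unitmx & V *m M = diag_mx (\row_i l i) *m V.
Proof.
move=> l_inj l_eig.
pose E i := eigenspace M (l i).
have dE : mxdirect (\sum_i E i) by apply: mxdirect_sum_eigenspace => i j _ _ /l_inj.
pose V := \matrix_i nz_row (E i).
have VE i : (row i V <= E i)%MS by rewrite rowK nz_row_sub.
have nzV i : nz_row (E i) != 0 by rewrite nz_row_eq0; apply: l_eig.
exists V; last first.
  apply/row_matrixP=> i; rewrite row_mul (eigenspaceP (VE i)).
  by apply/rowP=> j; rewrite mul_diag_mx !mxE.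
rewrite -row_full_unit -sub1mx.
have rk1 i : (1 <= \rank (E i))%N by rewrite lt0n mxrank_eq0; apply: l_eig.
have sE : \rank (\sum_i E i)%MS = (\sum_i \rank (E i))%N by rewrite (mxdirectP dE) /=.
have le_n : (\sum_i \rank (E i) <= n)%N by rewrite -sE rank_leq_col.
have sum1 : (\sum_(i < n) 1)%N = n by rewrite sum1_card card_ord.
have [ge_n eq_n] :
    (\sum_(i < n) 1 <= \sum_i \rank (E i) ?= iff [forall i, 1 == \rank (E i)])%N.
  by apply: leqif_sum => i _; apply: leqif_eq.
rewrite sum1 in ge_n eq_n.
have eqn : n = (\sum_i \rank (E i))%N by apply/eqP; rewrite eqn_leq ge_n.
have fullE : row_full (\sum_i E i)%MS by rewrite /row_full sE -eqn.
move: eq_n; rewrite -eqn eqxx => /esym/forallP rkE.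
apply: (submx_trans (_ : 1%:M <= \sum_i E i)%MS); first by rewrite sub1mx.
apply/sumsmx_subP=> i _; apply: (submx_trans _ (row_sub i V)).
rewrite -(mxrank_leqif_sup (VE i)).2 rowK rank_rV nzV.
exact: rkE i.
Qed.

Lemma eigenvalue_tr (F : fieldType) (n : nat) (M : 'M[F]_n) (z : F) :
  eigenvalue M^T z = eigenvalue M z.
Proof.
rewrite !eigenvalue_root_char /char_poly -[in RHS]det_tr.
by rewrite /char_poly_mx -map_trmx linearB /= tr_scalar_mx.
Qed.

Lemma right_eigenvectorP (F : fieldType) (n : nat) (M : 'M[F]_n) (z : F) :
  reflect (exists2 x : 'cV[F]_n, M *m x = z *: x & x != 0) (eigenvalue M z).
Proof.
rewrite -eigenvalue_tr; apply: (iffP eigenvalueP) => -[x xM x0]; exists x^T.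
- by apply: trmx_inj; rewrite trmx_mul trmxK xM linearZ /= trmxK.
- by rewrite trmx_eq0.
- by rewrite -trmx_mul xM linearZ.
- by rewrite trmx_eq0.
Qed.

Section DistinctEigenvalues.
Variables (F : fieldType) (n : nat) (M : 'M[F]_n) (l : 'I_n -> F).
Hypothesis l_inj : injective l.
Hypothesis l_eig : forall i, eigenvalue M (l i).

Lemma eigenvalue_distinct z : eigenvalue M z -> exists i, z = l i.
Proof.
have [V Vu VM] := eigenbasis l_inj l_eig.
case/right_eigenvectorP=> x Mx x0.
have Vx0 : V *m x != 0.
  by apply: contra x0 => /eqP Vx; rewrite -(mulKmx Vu x) Vx mulmx0.
have [i Vxi] : exists i, (V *m x) i 0 != 0.
  by apply/existsP; apply: contraR Vx0 => /existsPn Vx; apply/eqP/colP=> i;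
     rewrite [RHS]mxE; apply/eqP/negPn/Vx.
exists i; apply: (mulIf Vxi).
have := congr1 (fun A : 'cV_n => A i 0) (mulmxA V M x).
by rewrite Mx VM -scalemxAr -mulmxA mul_diag_mx !mxE => ->.
Qed.

(** Written as [a *m V], an eigenvector for [l i] satisfies [(l k - l i) a_k = 0], so only
    coordinate [i] survives and the eigenspace is a line. *)
Lemma left_eigenvector_unique i (y y' : 'rV[F]_n) :
  y *m M = l i *: y -> y' *m M = l i *: y' -> y != 0 ->
  exists k, y' = k *: y.
Proof.
have [V Vu VM] := eigenbasis l_inj l_eig.
have coord (w : 'rV_n) : w *m M = l i *: w -> exists k, w = k *: row i V.
  have [a ->] : exists a, w = a *m V by exists (w *m invmx V); rewrite mulmxKV.
  move=> wM; have aD : a *m diag_mx (\row_i l i) = l i *: a.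
    apply: (can_inj (mulmxK Vu)); rewrite -scalemxAl -wM.
    by rewrite -!mulmxA VM.
  exists (a 0 i); apply/rowP=> j; rewrite !mxE.
  rewrite (bigD1 i) //= big1 ?addr0 // => k ki.
  suff -> : a 0 k = 0 by rewrite mul0r.
  have /eqP := congr1 (fun A : 'rV_n => A 0 k) aD.
  rewrite mul_mx_diag !mxE mulrC -subr_eq0 -mulrBl mulf_eq0 subr_eq0.
  by rewrite (inj_eq l_inj) (negPf ki) => /eqP.
move=> /coord[k yE] /coord[k' y'E] y0.
have k0 : k != 0 by apply: contra y0 => /eqP k0; rewrite yE k0 scale0r.
by exists (k' / k); rewrite yE scalerA divfK.
Qed.

(** [x] is orthogonal to the left eigenvectors for every other eigenvalue. Were it also orthogonal
    to [y], it would be killed by the whole basis [V]. *)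
Lemma left_right_eigenvector i (y : 'rV[F]_n) (x : 'cV[F]_n) :
  y *m M = l i *: y -> y != 0 -> M *m x = l i *: x -> x != 0 ->
  (y *m x) 0 0 != 0.
Proof.
move=> yM y0 Mx x0; apply/eqP=> yx.
have [V Vu VM] := eigenbasis l_inj l_eig.
suff Vx : V *m x = 0 by rewrite -(mulKmx Vu x) Vx mulmx0 eqxx in x0.
apply/colP=> j; rewrite [RHS]mxE.
have Vj : row j V *m M = l j *: row j V.
  by rewrite -row_mul VM; apply/rowP=> k; rewrite mul_diag_mx !mxE.
have rowj : (V *m x) j 0 = (row j V *m x) 0 0 by rewrite -row_mul [RHS]mxE.
rewrite rowj; have [ij|ij] := eqVneq i j.
  rewrite -ij in Vj *.
  have [k ->] := left_eigenvector_unique yM Vj y0.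
  by rewrite -scalemxAl [LHS]mxE yx mulr0.
have /eqP : l i * (row j V *m x) 0 0 = l j * (row j V *m x) 0 0.
  have := congr1 (fun A : 'M[F]_1 => A 0 0) (mulmxA (row j V) M x).
  by rewrite Mx Vj -scalemxAl -scalemxAr [LHS]mxE [RHS]mxE.
rewrite -subr_eq0 -mulrBl mulf_eq0.
by rewrite subr_eq0 (inj_eq l_inj) (negPf ij) => /eqP.
Qed.

End DistinctEigenvalues.

(** * Spectrum of [Armx] and dimension of the unstable block *)

Section DeflatedShift.
Variables (F : fieldType) (n : nat) (Aq : 'M[F]_n) (b : 'cV[F]_n) (c : 'rV[F]_n).
Variables (l : 'I_n -> F) (i0 : 'I_n) (e : F).
Let beta := (c *m b) 0 0.
Let shifted := Aq + e *: (1%:M - beta^-1 *: (b *m c)).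
Hypotheses (beta0 : beta != 0) (cAq : c *m Aq = 0).

Lemma mulmx_shifted (y : 'rV[F]_n) :
  y *m shifted = y *m Aq + e *: y - (e * ((y *m b) 0 0 / beta)) *: c.
Proof.
rewrite mulmxDr -scalemxAr mulmxBr mulmx1 -scalemxAr mulmxA.
rewrite {1}[y *m b]mx11_scalar mul_scalar_mx scalerBr !scalerA addrA.
by rewrite [_ / beta]mulrC mulrA.
Qed.

Hypothesis l_eig : forall i, eigenvalue Aq (l i).
Hypothesis lF0 : forall i, i != i0 -> l i != 0 /\ l i + e != 0.

(** [c] is a left eigenvector of [shifted] for 0, and the shift acts on [y] as [e] up to a multiple
    of [c]; so an eigenvector of [Aq] for [l i] becomes one of [shifted] after adding a multiple of
    [c]. The sum is nonzero because [Aq] kills the multiples of [c] while [l i != 0]. *)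
Lemma eigenvalue_shifted i : eigenvalue shifted (if i == i0 then 0 else l i + e).
Proof.
have c0 : c != 0.
  by apply: contra beta0 => /eqP c0; rewrite /beta c0 mul0mx mxE.
have cS : c *m shifted = 0.
  by rewrite mulmx_shifted cAq divff // mulr1 add0r subrr.
apply/eigenvalueP; case: eqVneq => [_|/lF0 [l0 a0]].
  by exists c; rewrite ?scale0r.
case/eigenvalueP: (l_eig i) => y yA y0.
set a := l i + e in a0 *.
set q := e * ((y *m b) 0 0 / beta); pose k := - (q / a).
(* [k] solves [(y + k c) shifted = a (y + k c)]. *)
exists (y + k *: c).
  rewrite mulmxDl -scalemxAl cS scaler0 addr0 mulmx_shifted yA -scalerDl -/a -/q.
  by rewrite scalerDr scalerA /k mulrN scaleNr mulrCA divff // mulr1.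
apply: contra y0; rewrite addrC addr_eq0 => /eqP yE.
have : l i *: y = 0 by rewrite -yA -[y]opprK -yE mulNmx -scalemxAl cAq scaler0 oppr0.
by move/eqP; rewrite scaler_eq0 (negPf l0).
Qed.

End DeflatedShift.

Section SchurOneUnstable.
Variables (R : rcfType) (n n1 n2 : nat) (M : 'M[R]_n) (U : 'M[R]_(n, n1 + n2)).
Variables (l : 'I_n -> R[i]) (i0 : 'I_n).
Hypothesis MU : ordered_schur M U.
Hypothesis l_inj : injective l.
Hypothesis l_eig : forall i, cplx_eigenvalue M (l i).
Hypothesis li0 : 0 < complex.Re (l i0).
Hypothesis l_neg : forall i, i != i0 -> complex.Re (l i) <= 0.

(** At most 1: the lower part [Y] of a right eigenbasis has a right inverse, hence rank [n2], yet
    only its column for [l i0] can be nonzero. At least 1: with an empty unstable block, [A11] would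
    have the eigenvalue [l i0]. *)
Lemma ordered_schur_unstable_dim : n2 = 1%N.
Proof.
case: MU => _ [UtU UUt] _ dl0 [Re11 Re22].
pose toC := real_complex R.
pose Nc := map_mx toC (U^T *m M *m U).
pose Uc := map_mx toC U.
have UcUt : Uc *m Uc^T = 1%:M by rewrite map_trmx -map_mxM UUt map_mx1.
have UtUc : Uc^T *m Uc = 1%:M by rewrite map_trmx -map_mxM UtU map_mx1.
pose A11 := map_mx toC (ulsubmx (U^T *m M *m U)).
pose A22 := map_mx toC (drsubmx (U^T *m M *m U)).
have NcE : Nc = block_mx A11 (ursubmx Nc) 0 A22.
  by rewrite -[LHS]submxK -map_ulsubmx -map_dlsubmx -map_drsubmx dl0 map_mx0.
have NcU : Nc *m Uc^T = Uc^T *m map_mx toC M.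
  by rewrite /Nc !map_mxM -map_trmx -mulmxA UcUt mulmx1.
have NcM p (W : 'M_(n, p)) : 
    Uc^T *m (map_mx toC M *m W) =
    col_mx (A11 *m usubmx (Uc^T *m W) + ursubmx Nc *m dsubmx (Uc^T *m W))
           (A22 *m dsubmx (Uc^T *m W)).
  rewrite mulmxA -NcU -mulmxA [in LHS]NcE -{1}[Uc^T *m W]vsubmxK mul_block_col.
  by rewrite mul0mx add0r.
apply/eqP; rewrite eqn_leq; apply/andP; split.
  have [V Vu VM] := eigenbasis l_inj l_eig.
  pose X := invmx V; pose Y := dsubmx (Uc^T *m X).
  have MX : map_mx toC M *m X = X *m diag_mx (\row_i l i).
    by apply: (can_inj (mulKmx Vu)); rewrite !mulmxA VM mulmxV // mul1mx mulmxK.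
  have AY : A22 *m Y = Y *m diag_mx (\row_i l i).
    by rewrite mul_dsub_mx -mulmxA -MX NcM col_mxKd.
  (* Each column of [Y] is zero or a right eigenvector of [A22] for [l j]. *)
  have colY j : j != i0 -> col j Y = 0.
    move=> ji0; apply: contraTeq (l_neg ji0) => Yj0.
    rewrite -ltNge; apply: Re22; apply/right_eigenvectorP; exists (col j Y) => //.
    by rewrite -/A22 !colE mulmxA AY -!colE; apply/colP=> k; rewrite mul_mx_diag !mxE mulrC.
  have Y1 : Y *m (V *m Uc *m col_mx 0 1%:M) = 1%:M.
    by rewrite mul_dsub_mx !mulmxA mulmxKV // UtUc mul1mx col_mxKd.
  have YE : Y = col i0 Y *m delta_mx 0 i0.
    apply/matrixP=> i j; rewrite [RHS]mxE big_ord1 [delta_mx _ _ _ _]mxE eqxx /=.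
    have [->|ji0] := eqVneq j i0; first by rewrite mulr1 [RHS]mxE.
    by have /colP/(_ i) := colY j ji0; rewrite [LHS]mxE [RHS]mxE mulr0.
  rewrite -[X in (X <= _)%N](mxrank1 R[i]) -Y1 YE -mulmxA.
  exact: mulmx_max_rank.
have /right_eigenvectorP[x Mx x0] := l_eig i0.
rewrite lt0n; apply: contraL li0 => /eqP n20.
rewrite -leNgt; apply: Re11; apply/right_eigenvectorP; exists (usubmx (Uc^T *m x)).
  have d0 : dsubmx (Uc^T *m x) = 0.
    by apply/matrixP=> -[k kn2]; have := kn2; rewrite {1}n20.
  have := NcM _ x; rewrite Mx -scalemxAr d0 !mulmx0 addr0.
  by move/(congr1 usubmx); rewrite col_mxKu linearZ.
apply: contra x0 => /eqP u0.
have d0 : dsubmx (Uc^T *m x) = 0.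
  by apply/matrixP=> -[k kn2]; have := kn2; rewrite {1}n20.
by rewrite -[x]mul1mx -UcUt -mulmxA -[Uc^T *m x]vsubmxK u0 d0 col_mx0 mulmx0.
Qed.

End SchurOneUnstable.

(** * Transfer functions *)

Lemma cplx_hornerM (R : rcfType) (p q : {poly R}) (s : R[i]) :
  cplx_horner (p * q) s = cplx_horner p s * cplx_horner q s.
Proof. by rewrite /cplx_horner rmorphM hornerM. Qed.

Section ReducedFraction.
Variables (R : rcfType) (f : {fraction {poly R}}) (N D : {poly R}).
Hypothesis D0 : D != 0.
Hypothesis fE : f = FracField.tofrac N / FracField.tofrac D.

(** Equality of fractions is cross-multiplication against the representative of [f]. After division
    by the gcd, denominator and numerator are coprime, and Gauss's lemma makes the denominator
    divide [D]. *)
Lemma rf_reduced : (rf_den f %| D) /\ N * rf_den f = D * rf_num f.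
Proof.
rewrite /rf_num /rf_den; set p := \n_(repr f); set q := \d_(repr f).
have q0 : q != 0 by apply: denom_ratioP.
have eqND : N * q = D * p.
  have piE : f = \pi_({fraction {poly R}})%qT (Ratio N D).
    rewrite fE; rewrite /GRing.mul /GRing.inv /= !generic_quotient.piE.
    by rewrite /FracField.mulf /FracField.invf !numden_Ratio ?oner_eq0 // mulr1 mul1r.
  have := FracField.equivf_r (Ratio N D); rewrite -piE.
  by rewrite !numden_Ratio.
have g0 : gcdp p q != 0 by rewrite gcdp_eq0 negb_and q0 orbT.
have eqr : N * (q %/ gcdp p q) = D * (p %/ gcdp p q).
  by apply: (mulIf g0); rewrite -!mulrA !divpK ?dvdp_gcdl ?dvdp_gcdr.
split=> //; have cop : coprimep (q %/ gcdp p q) (p %/ gcdp p q).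
  by rewrite coprimep_sym coprimep_div_gcd // q0 orbT.
by rewrite -(Gauss_dvdpl _ cop) -eqr dvdp_mull.
Qed.

Lemma rf_pole_root s : rf_pole f s -> cplx_horner D s = 0.
Proof.
rewrite /rf_pole => pole; have [/dvdpP[k ->] _] := rf_reduced.
by rewrite cplx_hornerM pole mulr0.
Qed.

Lemma rf_evalE s : cplx_horner D s != 0 ->
  rf_eval f s = cplx_horner N s / cplx_horner D s.
Proof.
move=> Ds0; have [_ eqr] := rf_reduced.
have den0 : cplx_horner (rf_den f) s != 0.
  by apply: contra Ds0 => /eqP /rf_pole_root ->.
apply/eqP; rewrite /rf_eval eqr_div // -!cplx_hornerM mulrC -eqr.
by rewrite mulrC.
Qed.

End ReducedFraction.

(** For a scalar value [g], [j] times [g] minus its conjugate is [-2 Im g], so the positivity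
    condition becomes [Im g < 0]. [N / D] may be unreduced: cancellation only removes poles. *)
Lemma SNI_scalar (R : rcfType) (G : 'M[{fraction {poly R}}]_1) (N D : {poly R}) :
  G 0 0 = FracField.tofrac N / FracField.tofrac D ->
  (forall s : R[i], 0 <= complex.Re s -> cplx_horner D s != 0) ->
  (forall w : R, 0 < w ->
     complex.Im (cplx_horner N (w *i) / cplx_horner D (w *i)) < 0) ->
  SNI G.
Proof.
move=> GE Ds ImG.
have D0 : D != 0.
  by apply: contraNneq (Ds 0 (lexx 0)) => ->; rewrite /cplx_horner rmorph0 horner0.
split=> [s [i [j]]|w w0 _].
  rewrite !ord1 => /(rf_pole_root D0 GE) Ds0 /Ds.
  by rewrite Ds0 eqxx.
set H := 'i *: _.
have Re0 : 0 <= complex.Re (w *i : R[i]) by [].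
have := ImG w w0; rewrite -(rf_evalE D0 GE (Ds _ Re0)).
set g := rf_eval _ _ => Img.
have HE : H = ((- 2 * complex.Im g)%:C)%:M.
  apply/matrixP=> i j; rewrite !ord1 !mxE -/g.
  case: g Img => a b /= _; apply/eqP; rewrite eq_complex /= ?mulr1n /=.
  by apply/andP; split; apply/eqP; ring.
have m0 : 0 < - 2 * complex.Im g by rewrite mulNr oppr_gt0 pmulr_rlt0 ?ltr0n.
rewrite HE; split.
  by rewrite tr_scalar_mx map_scalar_mx /= oppr0.
move=> v v0; rewrite mul_mx_scalar -scalemxAl mxE pmulr_rgt0 ?ltcR //.
have v00 : v 0 0 != 0.
  by apply: contra v0 => /eqP v0; apply/eqP/matrixP=> i j; rewrite !ord1 v0 mxE.
by rewrite mxE big_ord1 !mxE mulrC -sqr_normc exprn_gt0 // normr_gt0.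
Qed.

(** The span of [C] and [u] is invariant under [Z], which is triangular on it, so [C Z^-1] comes
    from a 2x2 system. *)
Lemma resolvent2 (F : fieldType) (n : nat) (Z : 'M[F]_n) (C u : 'rV[F]_n)
    (B : 'cV[F]_n) (e s k : F) :
  Z \in unitmx -> e != 0 -> s != 0 ->
  C *m Z = e *: C + k *: u -> u *m Z = s *: u ->
  (C *m invmx Z *m B) 0 0 = ((C *m B) 0 0 * s - k * (u *m B) 0 0) / (e * s).
Proof.
move=> Zu e0 s0 CZ uZ.
have -> : C *m invmx Z = e^-1 *: (C - (k / s) *: u).
  apply: (can_inj (mulmxK Zu)); rewrite mulmxKV // -scalemxAl mulmxBl -scalemxAl.
  by rewrite CZ uZ scalerA divfK // addrK scalerA mulVf // scale1r.
rewrite -scalemxAl mulmxBl -scalemxAl.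
have -> : (e^-1 *: (C *m B - (k / s) *: (u *m B))) 0 0 =
    e^-1 * ((C *m B) 0 0 - k / s * (u *m B) 0 0) by rewrite !mxE.
by field; rewrite s0 e0.
Qed.

Lemma transfer2 (R : rcfType) (n : nat) (M : 'M[R]_n) (B : 'cV[R]_n)
    (C u : 'rV[R]_n) (e s k : R) :
  C *m M = - e *: C - k *: u -> u *m M = - s *: u ->
  transfer M B C 0 0 =
    FracField.tofrac (((C *m B) 0 0)%:P * ('X + s%:P) - (k * (u *m B) 0 0)%:P) /
    FracField.tofrac (('X + e%:P) * ('X + s%:P)).
Proof.
move=> CM uM; pose tofrac := @FracField.tofrac {poly R}.
pose io := (tofrac \o polyC) : {rmorphism R -> {fraction {poly R}}}.
rewrite /transfer.
have -> p q (W : 'M[R]_(p, q)) : map_mx (@rf_const R) W = map_mx io W by [].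
set Z := _ - _.
have Zu : Z \in unitmx.
  (* [Z] is the characteristic matrix over the rational functions; its determinant is a monic
     polynomial, hence nonzero. *)
  have -> : Z = map_mx tofrac (char_poly_mx M).
    by rewrite /char_poly_mx map_mxB map_scalar_mx -map_mx_comp.
  rewrite unitmxE det_map_mx unitfE tofrac_eq0.
  exact: monic_neq0 (char_poly_monic M).
have monicX a : tofrac ('X + a%:P) != 0.
  by rewrite tofrac_eq0 -[a]opprK polyCN monic_neq0 // monicXsubC.
have rowE (y : 'rV[R]_n) : map_mx io y *m Z =
    tofrac 'X *: map_mx io y - map_mx io (y *m M).
  by rewrite mulmxBr mul_mx_scalar map_mxM.
have E0 := monicX e; have S0 := monicX s.
have CZ : map_mx io C *m Z = tofrac ('X + e%:P) *: map_mx io C + io k *: map_mx io u.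
  rewrite rowE CM map_mxB !map_mxZ rmorphN scaleNr opprB opprK addrCA.
  by rewrite -scalerDl addrC /tofrac tofracD.
have uZ : map_mx io u *m Z = tofrac ('X + s%:P) *: map_mx io u.
  by rewrite rowE uM map_mxZ rmorphN scaleNr opprK -scalerDl /tofrac tofracD.
have -> := resolvent2 (map_mx io B) Zu E0 S0 CZ uZ.
rewrite -!map_mxM tofracB !tofracM polyCM tofracM.
by rewrite [map_mx io (C *m B) 0 0]mxE [map_mx io (u *m B) 0 0]mxE.
Qed.

Lemma cplx_hornerXaddC (R : rcfType) (a : R) (s : R[i]) :
  cplx_horner ('X + a%:P) s = s + a%:C.
Proof. by rewrite /cplx_horner rmorphD /= map_polyX map_polyC hornerD hornerX hornerC. Qed.

Lemma cplx_hornerC (R : rcfType) (a : R) (s : R[i]) : cplx_horner a%:P s = a%:C.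
Proof. by rewrite /cplx_horner map_polyC hornerC. Qed.

Lemma Im_second_order_lt0 (R : rcfType) (rho e mu nu w : R) :
  0 < rho -> 0 < e -> 0 <= mu -> 0 <= nu -> 0 < w ->
  complex.Im (rho%:C * (w *i + (e + nu)%:C) /
              ((w *i + e%:C) * (w *i + (e + mu)%:C))) < 0.
Proof.
move=> rho0 e0 mu0 nu0 w0.
have P0 : 0 < (e ^+ 2 + w ^+ 2)^-1 by rewrite invr_gt0; nra.
have Q0 : 0 < ((e + mu) ^+ 2 + w ^+ 2)^-1 by rewrite invr_gt0; nra.
have p0 : e ^+ 2 + w ^+ 2 != 0 by rewrite -invr_eq0 gt_eqF.
have q0 : (e + mu) ^+ 2 + w ^+ 2 != 0 by rewrite -invr_eq0 gt_eqF.
have inv1 a : w *i + a%:C != 0 by rewrite eq_complex /= addr0 (gt_eqF w0) andbF.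
have -> : rho%:C * (w *i + (e + nu)%:C) / ((w *i + e%:C) * (w *i + (e + mu)%:C)) =
  (rho / (e ^+ 2 + w ^+ 2) / ((e + mu) ^+ 2 + w ^+ 2))%:C *
  (((e + nu) +i* w) * (e -i* w) * ((e + mu) -i* w)).
  apply: (canLR (mulfK _)); first by rewrite mulf_neq0.
  apply/eqP; rewrite eq_complex /=; apply/andP; split; apply/eqP; field;
    by rewrite p0 q0.
have -> : forall x : R, complex.Im (x%:C * (((e + nu) +i* w) * (e -i* w) * ((e + mu) -i* w)))
    = - (x * (w * (w ^+ 2 + e ^+ 2 + 2 * e * nu + mu * nu))).
  by move=> x /=; ring.
rewrite oppr_lt0 mulr_gt0 // ?mulr_gt0 //.
by have := mulr_ge0 mu0 nu0; nra.
Qed.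

(* The transfer function is [rho (s + e + nu) / ((s + e) (s + e + mu))] with
   [rho = C B]. *)
Lemma SNI_second_order (R : rcfType) (n : nat) (M : 'M[R]_n) (B : 'cV[R]_n)
    (C u : 'rV[R]_n) (e mu nu k : R) :
  C *m M = - e *: C - k *: u -> u *m M = - (e + mu) *: u ->
  0 < e -> 0 <= mu -> 0 <= nu -> 0 < (C *m B) 0 0 ->
  k * (u *m B) 0 0 = (C *m B) 0 0 * (mu - nu) ->
  SNI (transfer M B C).
Proof.
move=> CM uM e0 mu0 nu0 rho0 kE; set rho := (C *m B) 0 0 in rho0 kE.
have Xadd0 a (s : R[i]) : 0 < a -> 0 <= complex.Re s -> s + a%:C != 0.
  move=> a0 s0; rewrite eq_complex /= negb_and; apply/orP; left.
  by case: s s0 => x y /= x0; rewrite gt_eqF // ltr_wpDl.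
apply: (@SNI_scalar _ _ (rho%:P * ('X + (e + nu)%:P)) (('X + e%:P) * ('X + (e + mu)%:P))).
(* The relation on [k] turns the numerator [rho (s + e + mu) - rho (mu - nu)] into
   [rho (s + e + nu)]. *)
- rewrite (transfer2 _ CM uM) -/rho kE.
  by congr (FracField.tofrac _ / _); rewrite polyCM polyCB !polyCD; ring.
- move=> s s0; rewrite cplx_hornerM !cplx_hornerXaddC mulf_neq0 //.
    exact: Xadd0.
  by apply: Xadd0 => //; lra.
- move=> w w0; rewrite !cplx_hornerM !cplx_hornerXaddC cplx_hornerC.
  exact: Im_second_order_lt0.
Qed.

(** * Closed-loop matrices *)

Section ClosedLoopMatrices.
Variables (R : rcfType) (n : nat) (A : 'M[R]_n) (B1 B2 : 'cV[R]_n) (C1 : 'rV[R]_n).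
Let beta := (C1 *m B2) 0 0.
Let rho := (C1 *m B1) 0 0.
Hypothesis beta0 : beta != 0.

Lemma RmxE : Rmx B1 C1 = (2 * rho)%:M.
Proof.
rewrite /Rmx -trmx_mul [C1 *m B1]mx11_scalar -/rho tr_scalar_mx -raddfD /=.
by congr (_%:M); ring.
Qed.

Lemma QmxE : Qmx B2 C1 = 1%:M - beta^-1 *: (B2 *m C1).
Proof.
by rewrite /Qmx [C1 *m B2]mx11_scalar invmx_scalar mul_mx_scalar -scalemxAl.
Qed.

Lemma mulmx_C1_Aqmx : C1 *m Aqmx A B2 C1 = 0.
Proof.
rewrite /Aqmx mulmxA QmxE mulmxBr mulmx1 -scalemxAr mulmxA.
by rewrite [C1 *m B2]mx11_scalar mul_scalar_mx scalerA mulVf // scale1r subrr mul0mx.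
Qed.

Lemma ArmxE e :
  Armx A B2 C1 e = Aqmx A B2 C1 + e *: (1%:M - beta^-1 *: (B2 *m C1)).
Proof. by rewrite /Armx mulmxDr -/(Aqmx A B2 C1) mul_mx_scalar QmxE. Qed.

Lemma mulmx_Armx e (y : 'rV[R]_n) :
  y *m Armx A B2 C1 e =
    y *m Aqmx A B2 C1 + e *: y - (e * ((y *m B2) 0 0 / beta)) *: C1.
Proof. by rewrite ArmxE mulmx_shifted. Qed.

Lemma mulmx_C1_Armx e : C1 *m Armx A B2 C1 e = 0.
Proof. by rewrite mulmx_Armx mulmx_C1_Aqmx add0r divff // mulr1 subrr. Qed.

(** [B2 (C1 B2)^-1 C1 = I - Q], so [feedback1] turns [A] into [A - (I - Q) (A + e I) = Q (A + e I) -
    e I]. The row [J] measures the deviation from that law. *)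
Lemma closed_loopE e (J : 'rV[R]_n) :
  A + B2 *m (feedback1 A B2 C1 e + beta^-1 *: J) =
  Armx A B2 C1 e - e%:M + beta^-1 *: (B2 *m J).
Proof.
rewrite mulmxDr addrA -scalemxAr; congr (_ + _).
rewrite /feedback1 /Armx /Qmx [C1 *m B2]mx11_scalar invmx_scalar -/beta.
rewrite mul_scalar_mx mul_mx_scalar mulmxBl mul1mx mulmxN -scalemxAr.
rewrite -!scalemxAl -mulmxA !mulmxDr mul_mx_scalar.
by rewrite addrAC addrK.
Qed.

Lemma feedback2E e (P : 'M[R]_n) :
  feedback2 A B1 B2 C1 e P = feedback1 A B2 C1 e +
    beta^-1 *: (B1^T *m P - (2 * rho / beta) *: (B2^T *m P)).
Proof.
rewrite /feedback2 /feedback1 RmxE -trmx_mul [C1 *m B2]mx11_scalar -/beta.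
rewrite tr_scalar_mx !invmx_scalar -scalar_mxM !mul_scalar_mx -scalemxAl.
rewrite -[- (beta^-1 *: _)]scalerN -scalerDr.
by congr (_ *: _); rewrite opprD addrCA !addrA.
Qed.

End ClosedLoopMatrices.

Lemma cplx_eigenvalue_shift (R : rcfType) (n : nat) (M : 'M[R]_n) (e : R) (z : R[i]) :
  cplx_eigenvalue (M - e%:M) z -> cplx_eigenvalue M (z + e%:C).
Proof.
case/eigenvalueP=> v vM v0; apply/eigenvalueP; exists v => //.
by rewrite scalerDl -vM map_mxB mulmxBr map_scalar_mx mul_mx_scalar subrK.
Qed.

(** * Distinct eigenvalues of [Armx] *)

Section Spectrum.
Variables (R : rcfType) (m : nat) (A : 'M[R]_m.+2) (B2 : 'cV[R]_m.+2).
Variables (C1 : 'rV[R]_m.+2) (lam : nat -> R[i]).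
Hypothesis hCB : C1 *m B2 != 0.
Hypothesis lam_eig : forall i, (1 <= i <= m.+2)%N -> cplx_eigenvalue (Aqmx A B2 C1) (lam i).
Hypothesis lam_dist : forall i j, (1 <= i <= m.+2)%N -> (1 <= j <= m.+2)%N ->
  lam i = lam j -> i = j.
Hypothesis lam_zero : lam m.+2 = 0.
Variable e : R.
Hypothesis lam_e : forall i, (1 <= i <= m.+1)%N -> lam i + e%:C != 0.

(** Ordinals start at 0, [lam] at 1. The last eigenvalue of [A_q], which is 0, is not shifted
    because [C1] stays in the left kernel. *)
Definition Armx_eig (i : 'I_m.+2) : R[i] :=
  if i == ord_max then 0 else lam i.+1 + e%:C.

Lemma lt_ord_max (i : 'I_m.+2) : i != ord_max -> (i < m.+1)%N.
Proof. by move=> im; rewrite ltn_neqAle -ltnS ltn_ord andbT. Qed.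

Lemma Armx_eigP i : cplx_eigenvalue (Armx A B2 C1 e) (Armx_eig i).
Proof.
have beta0 : (C1 *m B2) 0 0 != 0.
  by apply: contra hCB => /eqP b0; rewrite [C1 *m B2]mx11_scalar b0 raddf0.
pose toC : {rmorphism R -> R[i]} := real_complex R.
have bE : (map_mx toC C1 *m map_mx toC B2) 0 0 = toC ((C1 *m B2) 0 0).
  by rewrite -map_mxM [LHS]mxE.
have ArmxcE : map_mx toC (Armx A B2 C1 e) = map_mx toC (Aqmx A B2 C1) + toC e *:
    (1%:M - ((map_mx toC C1 *m map_mx toC B2) 0 0)^-1 *: (map_mx toC B2 *m map_mx toC C1)).
  by rewrite ArmxE bE map_mxD map_mxZ map_mxB map_mxZ map_mx1 (map_mxM _ B2 C1) fmorphV.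
rewrite /cplx_eigenvalue ArmxcE /Armx_eig.
apply: (@eigenvalue_shifted _ _ _ _ _ (fun i : 'I_m.+2 => lam i.+1)).
- by rewrite bE fmorph_eq0.
- by rewrite -map_mxM mulmx_C1_Aqmx // map_mx0.
- by move=> j; apply: lam_eig; rewrite /= ltn_ord.
- move=> j /lt_ord_max jm; split; last exact: lam_e.
  apply/eqP; rewrite -lam_zero => /lam_dist; rewrite !ltnS leqnn (ltnW jm).
  move=> /(_ isT isT) [jE].
  by rewrite jE ltnn in jm.
Qed.

Lemma Armx_eig_inj : injective Armx_eig.
Proof.
move=> i j; rewrite /Armx_eig.
case: eqVneq => [->|im]; case: eqVneq => [->|jm] //.
- by move/esym/eqP; rewrite (negPf (lam_e _)) //= lt_ord_max.
- by move/eqP; rewrite (negPf (lam_e _)) //= lt_ord_max.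
by move/addIr/lam_dist => /(_ (ltn_ord i) (ltn_ord j)) [ij]; apply: val_inj.
Qed.

End Spectrum.

(** * The first feedback law *)

Lemma feedback1_SNI_with_degree (R : rcfType) (n : nat) (A : 'M[R]_n)
    (B1 B2 : 'cV[R]_n) (C1 : 'rV[R]_n) (e : R) :
  (C1 *m B2) 0 0 != 0 -> 0 < (C1 *m B1) 0 0 -> 0 < e ->
  (forall z, cplx_eigenvalue (Armx A B2 C1 e) z -> complex.Re z <= 0) ->
  closed_loop_SNI_with_degree A B1 B2 C1 (feedback1 A B2 C1 e) e.
Proof.
move=> beta0 rho0 e0 Armx_le0.
have clE : A + B2 *m feedback1 A B2 C1 e = Armx A B2 C1 e - e%:M.
  by have := closed_loopE A B2 C1 e 0; rewrite mulmx0 !scaler0 !addr0.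
rewrite /closed_loop_SNI_with_degree clE; split; last first.
  move=> z /cplx_eigenvalue_shift/Armx_le0; case: z => x y /= ?; lra.
have cM : C1 *m (Armx A B2 C1 e - e%:M) = - e *: C1.
  by rewrite mulmxBr mulmx_C1_Armx // mul_mx_scalar sub0r scaleNr.
(* Taking [u = C1] and [k = mu = nu = 0] gives [rho (s + e) / (s + e)^2 = rho / (s + e)]. *)
apply: (@SNI_second_order _ _ _ _ _ C1 e 0 0 0) => //.
- by rewrite cM scale0r subr0.
- by rewrite cM addr0.
- by rewrite mul0r subrr mulr0.
Qed.

(** * The Lyapunov conditions for a 1x1 unstable block *)

Section RankOneLyapunov.
Variables (R : rcfType) (n n1 : nat) (A : 'M[R]_n) (B1 B2 : 'cV[R]_n) (C1 : 'rV[R]_n).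
Variables (e a : R) (U : 'M[R]_(n, n1 + 1)).
Let beta := (C1 *m B2) 0 0.
Let rho := (C1 *m B1) 0 0.
Let u := dsubmx U^T.
Let x := (u *m B2) 0 0 / beta.
Let y := (u *m B1) 0 0 / (2 * rho).
Hypothesis beta0 : beta != 0.
Hypothesis rho0 : 0 < rho.
Hypothesis a0 : 0 < a.
Hypothesis A22E : A22 A B2 C1 e U = a%:M.

Lemma C22_rank1 : C22 B1 B2 C1 U = (x - y)%:M.
Proof.
rewrite /C22 -mul_dsub_mx RmxE [C1 *m B2]mx11_scalar !invmx_scalar !mul_mx_scalar.
rewrite mulmxBr -!scalemxAr -/u [u *m B1]mx11_scalar [u *m B2]mx11_scalar.
by rewrite -!mul_scalar_mx -!scalar_mxM -raddfB /= ![_^-1 * _]mulrC.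
Qed.

Lemma B22_rank1 : B22 B1 U = (2 * rho * y)%:M.
Proof.
rewrite /B22 -mul_dsub_mx [LHS]mx11_scalar -/u /y mulrC divfK //.
by rewrite mulf_neq0 ?gt_eqF // pnatr_eq0.
Qed.

(** 1x1 matrices are scalars, so the equations read [2 a t = 2 rho (x - y)^2] and
    [2 a s = 2 rho y^2]. *)
Lemma lyapunov_equations_rank1 (t s : R) :
  (- (A22 A B2 C1 e U *m t%:M) - t%:M *m (A22 A B2 C1 e U)^T
     + C22 B1 B2 C1 U *m Rmx B1 C1 *m (C22 B1 B2 C1 U)^T = 0 <->
   a * t = rho * (x - y) ^+ 2) /\
  (- (A22 A B2 C1 e U *m s%:M) - s%:M *m (A22 A B2 C1 e U)^T
     + B22 B1 U *m invmx (Rmx B1 C1) *m (B22 B1 U)^T = 0 <->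
   a * s = rho * y ^+ 2).
Proof.
have scalar_eq0 (z : R) : z%:M = 0 :> 'M_1 <-> z = 0.
  split=> [/matrixP/(_ 0 0)|->]; first by rewrite !mxE eqxx mulr1n.
  by rewrite raddf0.
rewrite A22E C22_rank1 B22_rank1 RmxE !tr_scalar_mx !invmx_scalar.
rewrite -!scalar_mxM -!raddfN -!raddfD /= -/rho.
have -> : 2 * rho * y * (2 * rho)^-1 * (2 * rho * y) = 2 * (rho * y ^+ 2).
  by field; rewrite gt_eqF.
by split; (apply: iff_trans; first exact: scalar_eq0); split=> h; lra.
Qed.

(** Subtract the two scalar equations and use [(x - y)^2 - y^2 = x (x - 2 y)]; positivity of [T - S]
    is tested on the vector 1. *)
Lemma lyapunov_solution_rank1 (T S : 'M[R]_1) :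
  lyapunov_solution A B1 B2 C1 e U T S ->
  0 < T 0 0 - S 0 0 /\ a * (T 0 0 - S 0 0) = rho * (x * (x - 2 * y)).
Proof.
rewrite {1}[T]mx11_scalar {1}[S]mx11_scalar.
have [eqTP eqSP] := lyapunov_equations_rank1 (T 0 0) (S 0 0).
case=> _ _ /eqTP eqT /eqSP eqS [_ /(_ 1%:M (oner_neq0 _))].
rewrite tr_scalar_mx mul1mx mulmx1 -raddfB mxE eqxx mulr1n => TS0.
by split=> //; rewrite mulrBr eqT eqS; ring.
Qed.

Lemma lyapunov_conditions_rank1 :
  0 < x * (x - 2 * y) -> lyapunov_conditions A B1 B2 C1 e U.
Proof.
move=> xy0; pose t := rho * (x - y) ^+ 2 / a; pose s := rho * y ^+ 2 / a.
have [a_ge0 rho_ge0] := (ltW a0, ltW rho0).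
have t0 : 0 <= t by rewrite divr_ge0 // mulr_ge0 // sqr_ge0.
have s0 : 0 <= s by rewrite divr_ge0 // mulr_ge0 // sqr_ge0.
have quad (z : R) (v : 'cV[R]_1) : (v^T *m z%:M *m v) 0 0 = z * (v 0 0) ^+ 2.
  rewrite mul_mx_scalar -scalemxAl [LHS]mxE; congr (_ * _).
  by rewrite [LHS]mxE big_ord1 mxE expr2.
exists t%:M, s%:M; split.
- split; first by rewrite tr_scalar_mx.
  by move=> v; rewrite quad mulr_ge0 ?sqr_ge0.
- split; first by rewrite tr_scalar_mx.
  by move=> v; rewrite quad mulr_ge0 ?sqr_ge0.
- by apply/(lyapunov_equations_rank1 _ 0).1; rewrite mulrC divfK ?gt_eqF.
- by apply/(lyapunov_equations_rank1 0 _).2; rewrite mulrC divfK ?gt_eqF.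
- rewrite -raddfB; split; first by rewrite tr_scalar_mx.
  move=> v v0; rewrite quad mulr_gt0 //.
    have -> : t - s = rho * (x * (x - 2 * y)) / a by rewrite /t /s; field; rewrite gt_eqF.
    by rewrite divr_gt0 // mulr_gt0.
  rewrite exprn_even_gt0 //=; apply: contra v0 => /eqP v0.
  by rewrite [v]mx11_scalar v0 raddf0.
Qed.

End RankOneLyapunov.

(** * Left invariant rows from the unstable Schur block *)

Section SchurRows.
Variables (R : rcfType) (n n1 : nat).

Lemma schur_unstable_rows n2 (M : 'M[R]_n) (U : 'M[R]_(n, n1 + n2)) :
  ordered_schur M U ->
  dsubmx U^T *m M = drsubmx (U^T *m M *m U) *m dsubmx U^T.
Proof.
case=> _ [_ UUt] _ dl0 _.
have -> : dsubmx U^T *m M = dsubmx (U^T *m M *m U *m U^T).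
  by rewrite -(mulmxA _ U) UUt mulmx1 mul_dsub_mx.
set N := U^T *m M *m U in dl0 *.
rewrite -{1}[N]submxK dl0 -{1}[U^T]vsubmxK mul_block_col col_mxKd.
by rewrite mul0mx add0r.
Qed.

Lemma dsubmx_orthogonal_neq0 (U : 'M[R]_(n, n1 + 1)) :
  U^T *m U = 1%:M -> dsubmx U^T != 0.
Proof.
move=> UtU; apply/eqP=> u0.
have : dsubmx U^T *m (U *m col_mx 0 1%:M) = 1%:M.
  by rewrite mulmxA mul_dsub_mx UtU mul_dsub_mx mul1mx col_mxKd.
by rewrite u0 mul0mx => /esym/eqP; rewrite oner_eq0.
Qed.

Lemma Pmx_dsubmx n2 (U : 'M[R]_(n, n1 + n2)) (T S : 'M[R]_n2) :
  Pmx U T S = (dsubmx U^T)^T *m invmx (T - S) *m dsubmx U^T.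
Proof.
rewrite /Pmx -{1}[U]trmxK -[U^T]vsubmxK tr_col_mx mul_row_block mul_row_col.
by rewrite !mulmx0 !add0r mul0mx add0r !col_mxKd.
Qed.

End SchurRows.

(** The proportionality factor is found over the complex numbers; since both rows are real, its real
    part works as well. *)
Lemma left_eigenvector_unique_real (R : rcfType) (n : nat) (M : 'M[R]_n)
    (l : 'I_n -> R[i]) (i : 'I_n) (a : R) (y y' : 'rV[R]_n) :
  injective l -> (forall j, cplx_eigenvalue M (l j)) -> l i = a%:C ->
  y *m M = a *: y -> y' *m M = a *: y' -> y != 0 -> exists k, y' = k *: y.
Proof.
move=> l_inj l_eig lia yM y'M y0.
pose toC : {rmorphism R -> R[i]} := real_complex R.
have mapM (w : 'rV[R]_n) : w *m M = a *: w ->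
    map_mx toC w *m map_mx toC M = l i *: map_mx toC w.
  by move=> wM; rewrite -map_mxM wM map_mxZ lia.
have yC0 : map_mx toC y != 0 by rewrite map_mx_eq0.
have [k y'E] := left_eigenvector_unique l_inj l_eig (mapM _ yM) (mapM _ y'M) yC0.
exists (complex.Re k); apply/rowP=> j.
have := congr1 (fun w : 'rV[R[i]]_n => complex.Re (w 0 j)) y'E.
by rewrite !mxE; case: k {y'E} => kr ki /= ->; rewrite mulr0 subr0.
Qed.

(** * The quadratic form behind the Lyapunov conditions *)

Section LyapunovForm.
Variables (R : rcfType) (n : nat) (A : 'M[R]_n) (B1 B2 : 'cV[R]_n) (C1 : 'rV[R]_n).
Let beta := (C1 *m B2) 0 0.
Let rho := (C1 *m B1) 0 0.
Hypothesis beta0 : beta != 0.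
Hypothesis rho0 : 0 < rho.

(** On the unstable row of [U^T] it equals [a (T - S) / rho]. *)
Definition lyapunov_form (v : 'rV[R]_n) : R :=
  let x := (v *m B2) 0 0 / beta in
  let y := (v *m B1) 0 0 / (2 * rho) in x * (x - 2 * y).

Lemma lyapunov_formZ k v : lyapunov_form (k *: v) = k ^+ 2 * lyapunov_form v.
Proof.
rewrite /lyapunov_form -!scalemxAl [(k *: (v *m B2)) 0 0]mxE [(k *: (v *m B1)) 0 0]mxE.
by ring.
Qed.

Variables (e g : R) (u : 'rV[R]_n).
Hypothesis g0 : 0 < g.
Hypothesis uM : u *m Armx A B2 C1 e = (e - g) *: u.

(** This undoes the correction made in [eigenvalue_shifted]; it is used with [g = - lam_(n-1)], so
    that [e - g = a]. *)
Definition Aqmx_row : 'rV[R]_n := u - (e * ((u *m B2) 0 0 / beta) / g) *: C1.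

Lemma mulmx_Aqmx_row : Aqmx_row *m Aqmx A B2 C1 = - g *: Aqmx_row.
Proof.
have uAq : u *m Aqmx A B2 C1 = - g *: u + (e * ((u *m B2) 0 0 / beta)) *: C1.
  have /eqP := uM; rewrite mulmx_Armx // -/beta subr_eq => /eqP/(canRL (addrK _)) ->.
  by rewrite addrAC -scalerBl addrAC subrr add0r.
have := mulmx_C1_Aqmx A beta0.
move: uAq; rewrite /Aqmx_row; move: (e * _) => q uAq cAq.
rewrite mulmxBl -scalemxAl cAq scaler0 subr0 uAq scalerBr scalerA.
by rewrite mulNr mulrCA divff ?gt_eqF // mulr1 (scaleNr q) opprK.
Qed.

Lemma Aqmx_row_neq0 : u != 0 -> e - g != 0 -> Aqmx_row != 0.
Proof.
move=> u0 a0; apply: contra u0; rewrite subr_eq0 => /eqP uE.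
have := uM; rewrite {1}uE -scalemxAl mulmx_C1_Armx // scaler0 => /esym/eqP.
by rewrite scaler_eq0 (negPf a0).
Qed.

(** Subtracting [c C1] lowers [x] by [c] and [y] by [c / 2], so [x - 2 y] is unchanged; for
    [c = e x / g] the factor [x] becomes [- ((e - g) / g) x]. *)
Lemma lyapunov_form_Aqmx_row :
  lyapunov_form Aqmx_row = - ((e - g) / g) * lyapunov_form u.
Proof.
rewrite /lyapunov_form /Aqmx_row !mulmxBl -!scalemxAl.
have subE (P Q : 'M[R]_1) k : (P - k *: Q) 0 0 = P 0 0 - k * Q 0 0 by rewrite !mxE.
rewrite !subE -/beta -/rho; field.
by rewrite beta0 !gt_eqF.
Qed.

End LyapunovForm.

(** * The second feedback law *)

Section UnstableFeedback.
Variables (R : rcfType) (n : nat) (A : 'M[R]_n) (B1 B2 : 'cV[R]_n) (C1 u : 'rV[R]_n).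
Variables (e a tau : R).
Let beta := (C1 *m B2) 0 0.
Let rho := (C1 *m B1) 0 0.
Let x := (u *m B2) 0 0 / beta.
Let y := (u *m B1) 0 0 / (2 * rho).
Hypothesis beta0 : beta != 0.
Hypothesis rho0 : 0 < rho.
Hypothesis a0 : 0 < a.
Hypothesis e0 : 0 < e.
Hypothesis uM : u *m Armx A B2 C1 e = a *: u.
Hypothesis form0 : 0 < x * (x - 2 * y).
Hypothesis tauE : tau * (rho * (x * (x - 2 * y))) = a.
Hypothesis Armx_le0 : forall z (v : 'cV[R[i]]_n),
  map_mx (real_complex R) (Armx A B2 C1 e) *m v = z *: v -> v != 0 ->
  map_mx (real_complex R) u *m v = 0 -> complex.Re z <= 0.

Let k := 2 * a * (x - y) / (x * (x - 2 * y)).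
Let mu := a * x / (x - 2 * y).
Let nu := a * (x - 2 * y) / x.

Let factors_neq0 : x != 0 /\ x - 2 * y != 0.
Proof. by apply/andP; rewrite -negb_or -mulf_eq0 gt_eqF. Qed.

Lemma feedback2_closed_loopE :
  A + B2 *m feedback2 A B1 B2 C1 e (tau *: (u^T *m u)) =
  Armx A B2 C1 e - e%:M - (k / beta) *: (B2 *m u).
Proof.
rewrite feedback2E closed_loopE -/beta; congr (_ + _).
(* For [P = tau u^T u] the extra feedback is a multiple of [u], namely
   [2 rho tau (y - x) u = - k u]. *)
have trE (w : 'cV[R]_n) : w^T *m (tau *: (u^T *m u)) = (tau * (u *m w) 0 0) *: u.
  rewrite -scalemxAr mulmxA -trmx_mul {1}[u *m w]mx11_scalar tr_scalar_mx.
  by rewrite mul_scalar_mx scalerA.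
rewrite !trE scalerA -scalerBl -scalemxAr scalerA -scaleNr; congr (_ *: _).
rewrite -/rho.
have [x0 D0] := factors_neq0.
have -> : (u *m B1) 0 0 = 2 * rho * y by rewrite /y; field; rewrite gt_eqF.
have -> : (u *m B2) 0 0 = beta * x by rewrite /x; field.
rewrite /k -tauE; move: beta0 x0 D0; move: beta rho x y tau => b r s t w b0 s0 d0.
by field; rewrite b0 s0 d0.
Qed.

Lemma feedback2_SNI_with_degree :
  closed_loop_SNI_with_degree A B1 B2 C1
    (feedback2 A B1 B2 C1 e (tau *: (u^T *m u))) e.
Proof.
have [x0 D0] := factors_neq0.
have CM : C1 *m (Armx A B2 C1 e - e%:M - (k / beta) *: (B2 *m u)) = - e *: C1 - k *: u.
  rewrite !mulmxBr mulmx_C1_Armx // mul_mx_scalar sub0r scaleNr -scalemxAr mulmxA.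
  by rewrite [C1 *m B2]mx11_scalar mul_scalar_mx scalerA divfK.
have uAcl : u *m (Armx A B2 C1 e - e%:M - (k / beta) *: (B2 *m u)) = - (e + mu) *: u.
  rewrite !mulmxBr uM mul_mx_scalar -scalemxAr mulmxA [u *m B2]mx11_scalar.
  rewrite mul_scalar_mx scalerA -!scalerBl; congr (_ *: _).
  have -> : k / beta * (u *m B2) 0 0 = k * x by rewrite /x; ring.
  by rewrite /k /mu; field; rewrite D0.
have mu0 : 0 < mu.
  have -> : mu = a * (x * (x - 2 * y)) / (x - 2 * y) ^+ 2 by rewrite /mu; field.
  by apply: divr_gt0; [apply: mulr_gt0 | rewrite exprn_even_gt0].
have nu0 : 0 < nu.
  have -> : nu = a * (x * (x - 2 * y)) / x ^+ 2 by rewrite /nu; field.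
  by apply: divr_gt0; [apply: mulr_gt0 | rewrite exprn_even_gt0].
rewrite /closed_loop_SNI_with_degree feedback2_closed_loopE; split.
  apply: (@SNI_second_order _ _ _ _ _ u e mu nu k) => //; try exact: ltW.
  rewrite -/rho.
  have -> : (u *m B1) 0 0 = 2 * rho * y by rewrite /y; field; rewrite gt_eqF.
  by rewrite /k /mu /nu; field; rewrite x0 D0.
move=> z /right_eigenvectorP[v Mv v0].
set M := _ - _ in uAcl Mv.
pose toC : {rmorphism R -> R[i]} := real_complex R.
(* If [u v = 0], the rank-one term does not act on [v], which is then an eigenvector of [Armx] to
   which [Armx_le0] applies. Otherwise pairing with the left eigenvector [u] gives
   [z = - (e + mu)]. *)
have [uv|uv] := eqVneq (map_mx toC u *m v) 0.
  have : complex.Re (z + e%:C) <= 0.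
    apply: (Armx_le0 _ v0 uv); rewrite scalerDl -Mv /M.
    rewrite !map_mxB map_mxZ map_scalar_mx (map_mxM toC B2 u) !mulmxBl -scalemxAl.
    rewrite -(mulmxA (map_mx toC B2)) uv.
    by rewrite mulmx0 scaler0 subr0 mul_scalar_mx subrK.
  by case: z {Mv} => zr zi /= ?; lra.
have : (- (e + mu))%:C *: (map_mx toC u *m v) = z *: (map_mx toC u *m v).
  by rewrite [RHS]scalemxAr -Mv mulmxA -map_mxM uAcl map_mxZ -scalemxAl.
move/eqP; rewrite -subr_eq0 -scalerBl scaler_eq0 (negPf uv) orbF subr_eq0 => /eqP <- /=.
by lra.
Qed.

End UnstableFeedback.

(** * Levels at which exactly one eigenvalue is unstable *)

Section UnstableLevel.
Variables (R : rcfType) (m : nat) (A : 'M[R]_m.+2) (B1 B2 : 'cV[R]_m.+2).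
Variables (C1 : 'rV[R]_m.+2) (lam : nat -> R[i]).
Hypothesis hCB : C1 *m B2 != 0.
Hypothesis rho0 : 0 < (C1 *m B1) 0 0.
Hypothesis lam_eig : forall i, (1 <= i <= m.+2)%N -> cplx_eigenvalue (Aqmx A B2 C1) (lam i).
Hypothesis lam_dist : forall i j, (1 <= i <= m.+2)%N -> (1 <= j <= m.+2)%N ->
  lam i = lam j -> i = j.
Hypothesis lam_ord : forall i j, (1 <= i)%N -> (i <= j)%N -> (j <= m.+1)%N ->
  complex.Re (lam i) <= complex.Re (lam j).
Hypothesis lam_neg : complex.Re (lam m.+1) < 0.
Hypothesis lam_zero : lam m.+2 = 0.

Let beta0 : (C1 *m B2) 0 0 != 0.
Proof. by apply: contra hCB => /eqP b0; rewrite [C1 *m B2]mx11_scalar b0 raddf0. Qed.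

(** Zero-based index of [lam m.+1], the one eigenvalue that the shift makes unstable. *)
Let i1 : 'I_m.+2 := Ordinal (leqnSn m.+1).

Section Level.
Variable e : R.
Hypothesis e_gt : - complex.Re (lam m.+1) < e.
Hypothesis e_lt : e < - complex.Re (lam m).

Let level_gt0 : 0 < e.
Proof. by apply: lt_trans e_gt; rewrite oppr_gt0. Qed.

Let Re_shift i : complex.Re (lam i + e%:C) = complex.Re (lam i) + e.
Proof. by case: (lam i). Qed.

Let Re_lam_lt0 i : (1 <= i <= m)%N -> complex.Re (lam i + e%:C) < 0.
Proof.
case/andP=> i1' im; rewrite Re_shift.
by have := lam_ord i1' im (leqnSn m); move: e_lt; lra.
Qed.

Let Re_lam_gt0 : 0 < complex.Re (lam m.+1 + e%:C).
Proof. by rewrite Re_shift; move: e_gt; lra. Qed.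

Let lam_e i : (1 <= i <= m.+1)%N -> lam i + e%:C != 0.
Proof.
case/andP=> i1'; rewrite leq_eqVlt => /orP[/eqP->|im]; apply/eqP=> z0.
  by have := Re_lam_gt0; rewrite z0 ltxx.
by have := @Re_lam_lt0 i; rewrite i1' -ltnS im z0 ltxx => /(_ isT).
Qed.

Let eig_i1 : Armx_eig lam e i1 = lam m.+1 + e%:C.
Proof. by rewrite /Armx_eig -val_eqE /= ltn_eqF. Qed.

Let eig_le0 i : i != i1 -> complex.Re (Armx_eig lam e i) <= 0.
Proof.
move=> ii1; rewrite /Armx_eig; case: eqVneq => // im; apply/ltW/Re_lam_lt0.
by rewrite /= ltn_neqAle -ltnS lt_ord_max // andbT -[m]/(val i1) val_eqE.
Qed.

Let eigP := Armx_eigP hCB lam_eig lam_dist lam_zero lam_e.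
Let eig_inj := Armx_eig_inj lam_dist lam_e.

Lemma level_schur_dim n1 n2 (U : 'M[R]_(m.+2, n1 + n2)) :
  ordered_schur (Armx A B2 C1 e) U -> n2 = 1%N.
Proof.
move=> schurU; apply: (ordered_schur_unstable_dim schurU eig_inj eigP _ eig_le0).
by rewrite eig_i1.
Qed.

Section Row.
Variables (n1 : nat) (U : 'M[R]_(m.+2, n1 + 1)).
Hypothesis schurU : ordered_schur (Armx A B2 C1 e) U.
Let u := dsubmx U^T.
Let a := e + complex.Re (lam m.+1).

(** The 1x1 real block is a real positive eigenvalue of [Armx], hence the one of index [i1]; this is
    also why [lam m.+1] is real. *)
Lemma level_A22 : A22 A B2 C1 e U = a%:M /\ lam m.+1 = (complex.Re (lam m.+1))%:C.
Proof.
case: (schurU) => _ _ _ _ [_ Re22].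
rewrite [A22 _ _ _ _ _]mx11_scalar; set b := A22 _ _ _ _ _ 0 0.
have AE : drsubmx (U^T *m Armx A B2 C1 e *m U) = b%:M by rewrite -mx11_scalar.
have b_eig : cplx_eigenvalue (drsubmx (U^T *m Armx A B2 C1 e *m U)) b%:C.
  apply/eigenvalueP; exists 1%:M; last exact: oner_neq0.
  by rewrite AE map_scalar_mx mul_mx_scalar.
have b0 := Re22 _ b_eig.
have uM := schur_unstable_rows schurU.
have b_eigM : cplx_eigenvalue (Armx A B2 C1 e) b%:C.
  apply/eigenvalueP; exists (map_mx (real_complex R) u).
    by rewrite -map_mxM uM AE mul_scalar_mx map_mxZ.
  by rewrite map_mx_eq0; apply: dsubmx_orthogonal_neq0; case: schurU => _ [].
have [j bj] := eigenvalue_distinct eig_inj eigP b_eigM.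
have ji1 : j = i1 by apply: contraTeq b0 => /eig_le0; rewrite -bj leNgt.
move: bj; rewrite ji1 eig_i1 /a; case: (lam m.+1) => lr li [-> ]; rewrite addr0 => <-.
by rewrite addrC.
Qed.

Lemma level_gt0_A22 : 0 < a.
Proof. by rewrite /a; move: e_gt; lra. Qed.

Lemma level_row : u *m Armx A B2 C1 e = a *: u.
Proof.
have := schur_unstable_rows schurU.
by rewrite -[drsubmx _]/(A22 A B2 C1 e U) (level_A22).1 mul_scalar_mx.
Qed.

Lemma level_row_neq0 : u != 0.
Proof. by apply: dsubmx_orthogonal_neq0; case: schurU => _ []. Qed.

Lemma level_lyapunov_conditions :
  lyapunov_conditions A B1 B2 C1 e U <-> 0 < lyapunov_form B1 B2 C1 u.
Proof.
split=> [[T [S /(lyapunov_solution_rank1 rho0 level_A22.1)[TS0 TSE]]]|].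
  move: TS0; rewrite -(pmulr_rgt0 _ level_gt0_A22) TSE pmulr_rgt0 //.
exact: (lyapunov_conditions_rank1 rho0 level_gt0_A22 level_A22.1).
Qed.

Lemma level_closed_loop (T S : 'M[R]_1) :
  lyapunov_solution A B1 B2 C1 e U T S ->
  closed_loop_SNI_with_degree A B1 B2 C1 (feedback2 A B1 B2 C1 e (Pmx U T S)) e.
Proof.
move=> solTS; have [TS0 TSE] := lyapunov_solution_rank1 rho0 level_A22.1 solTS.
have -> : Pmx U T S = (T 0 0 - S 0 0)^-1 *: (u^T *m u).
  rewrite Pmx_dsubmx [T]mx11_scalar [S]mx11_scalar -raddfB invmx_scalar /=.
  by rewrite mul_mx_scalar -scalemxAl !mxE !eqxx !mulr1n.
apply: (feedback2_SNI_with_degree beta0 rho0 level_gt0_A22 level_gt0 level_row).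
- have := level_lyapunov_conditions.1; apply; by exists T, S.
- by rewrite -TSE mulrCA mulVf ?mulr1 // gt_eqF.
move=> z v Mv v0 uv.
have z_eig : cplx_eigenvalue (Armx A B2 C1 e) z by apply/right_eigenvectorP; exists v.
have [j zj] := eigenvalue_distinct eig_inj eigP z_eig.
(* If [j = i1], then [u] and [v] are left and right eigenvectors for the same simple eigenvalue, so
   [u v = 0] is impossible. *)
have [ji1|/eig_le0] := eqVneq j i1; last by rewrite -zj.
have uC : map_mx (real_complex R) u *m map_mx (real_complex R) (Armx A B2 C1 e) =
    z *: map_mx (real_complex R) u.
  rewrite -map_mxM level_row map_mxZ; congr (_ *: _).
  rewrite zj ji1 eig_i1 /a rmorphD addrC /=.
  by rewrite -level_A22.2.
have uC0 : map_mx (real_complex R) u != 0 by rewrite map_mx_eq0 level_row_neq0.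
rewrite zj in uC Mv.
have := left_right_eigenvector eig_inj eigP uC uC0 Mv v0.
by rewrite uv mxE eqxx.
Qed.

End Row.
End Level.

(** Both rows are corrected to left eigenvectors of [A_q] for the same simple real eigenvalue, hence
    are then proportional; rescaling multiplies the form by a square, and each correction by a
    negative factor. *)
Lemma lyapunov_form_level e e' n1 n1' (U : 'M[R]_(m.+2, n1 + 1)) (U' : 'M[R]_(m.+2, n1' + 1)) :
  - complex.Re (lam m.+1) < e < - complex.Re (lam m) ->
  - complex.Re (lam m.+1) < e' < - complex.Re (lam m) ->
  ordered_schur (Armx A B2 C1 e) U -> ordered_schur (Armx A B2 C1 e') U' ->
  0 < lyapunov_form B1 B2 C1 (dsubmx U^T) ->
  0 < lyapunov_form B1 B2 C1 (dsubmx U'^T).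
Proof.
case/andP=> e1 e2 /andP[e1' e2'] schurU schurU' form0.
set g := - complex.Re (lam m.+1) in e1 e1' *.
have g0 : 0 < g by rewrite oppr_gt0.
have uM : dsubmx U^T *m Armx A B2 C1 e = (e - g) *: dsubmx U^T.
  by rewrite opprK; apply: level_row.
have uM' : dsubmx U'^T *m Armx A B2 C1 e' = (e' - g) *: dsubmx U'^T.
  by rewrite opprK; apply: level_row.
have eg0 : 0 < e - g by rewrite subr_gt0.
have eg0' : 0 < e' - g by rewrite subr_gt0.
have vM := mulmx_Aqmx_row beta0 g0 uM.
have vM' := mulmx_Aqmx_row beta0 g0 uM'.
have v0' := Aqmx_row_neq0 beta0 uM' (level_row_neq0 schurU') (lt0r_neq0 eg0').
have lE : lam m.+1 = (- g)%:C by rewrite opprK; exact: (level_A22 e1 e2 schurU).2.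
have l_inj : injective (fun i : 'I_m.+2 => lam i.+1).
  by move=> i j /lam_dist => /(_ (ltn_ord i) (ltn_ord j)) [ij]; apply: val_inj.
have l_eig (i : 'I_m.+2) : cplx_eigenvalue (Aqmx A B2 C1) (lam i.+1).
  by apply: lam_eig; rewrite /= ltn_ord.
have [k vE] := left_eigenvector_unique_real l_inj l_eig (lE : lam i1.+1 = _) vM' vM v0'.
have formE := lyapunov_form_Aqmx_row beta0 rho0 e (dsubmx U^T) g0.
have formE' := lyapunov_form_Aqmx_row beta0 rho0 e' (dsubmx U'^T) g0.
move: formE; rewrite vE lyapunov_formZ formE' => formE.
set f := lyapunov_form _ _ _ _ in form0 formE; set f' := lyapunov_form _ _ _ _ in formE *.
(* [f' <= 0] would make the left side of [formE] nonnegative, while [0 < f] makes its right side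
   negative. *)
rewrite ltNge; apply/negP=> f'0.
have : 0 <= k ^+ 2 * (- ((e' - g) / g) * f').
  by rewrite mulr_ge0 ?sqr_ge0 // mulNr -mulrN mulr_ge0 ?oppr_ge0 // divr_ge0 // ltW.
rewrite formE mulNr oppr_ge0 leNgt => /negP; apply.
by apply: mulr_gt0 => //; apply: divr_gt0.
Qed.

End UnstableLevel.

(** * Both feedback laws under the assumptions of the theorem *)

Unset Implicit Arguments.

Theorem mainTheorem2 (R : realType) (n : nat) (A : 'M[R]_n)
    (B1 B2 : 'cV[R]_n) (C1 : 'rV[R]_n)
    (* the eigenvalues of A_q are lam 1, ..., lam n; other values are junk *)
    (lam : nat -> R[i])
    (hn : (2 <= n)%N)
    (hCB : C1 *m B2 != 0)
    (hR : 0 < Rmx B1 C1 0 0)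
    (hctrl : controllable A B2)
    (hlam_eig : forall i : nat, (1 <= i <= n)%N ->
       cplx_eigenvalue (Aqmx A B2 C1) (lam i))
    (hlam_dist : forall i j : nat, (1 <= i <= n)%N -> (1 <= j <= n)%N ->
       lam i = lam j -> i = j)
    (hstable : forall z : R[i], cplx_eigenvalue (Aqmx A B2 C1) z ->
       ~ (0 < complex.Re z))
    (hlam_ord : forall i j : nat, (1 <= i)%N -> (i <= j)%N -> (j <= n.-1)%N ->
       complex.Re (lam i) <= complex.Re (lam j))
    (hlam_neg : complex.Re (lam n.-1) < 0)
    (hlam_zero : lam n = 0) :
  (forall e : R, 0 < e -> e < - complex.Re (lam n.-1) ->
     closed_loop_SNI_with_degree A B1 B2 C1 (feedback1 A B2 C1 e) e)
  /\
  ((3 <= n)%N ->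
   (exists (e0 : R) (n1 n2 : nat) (U0 : 'M[R]_(n, n1 + n2)),
      [/\ - complex.Re (lam n.-1) < e0,
          e0 < - complex.Re (lam n.-2),
          ordered_schur (Armx A B2 C1 e0) U0 &
          lyapunov_conditions A B1 B2 C1 e0 U0]) ->
   forall e : R, - complex.Re (lam n.-1) < e -> e < - complex.Re (lam n.-2) ->
   forall (n1 n2 : nat) (U : 'M[R]_(n, n1 + n2)),
     ordered_schur (Armx A B2 C1 e) U ->
     lyapunov_conditions A B1 B2 C1 e U /\
     (forall T S : 'M[R]_n2, lyapunov_solution A B1 B2 C1 e U T S ->
        closed_loop_SNI_with_degree A B1 B2 C1
          (feedback2 A B1 B2 C1 e (Pmx U T S)) e)).
Proof.
case: n hn => [//|[//|m]] _ in A B1 B2 C1 hCB hR hctrl hlam_eig hlam_dist hstable hlam_ord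
  hlam_neg hlam_zero *.
rewrite /= in hlam_ord hlam_neg *.
have rho0 : 0 < (C1 *m B1) 0 0.
  by move: hR; rewrite RmxE mxE eqxx mulr1n pmulr_rgt0.
have beta0 : (C1 *m B2) 0 0 != 0.
  by apply: contra hCB => /eqP b0; rewrite [C1 *m B2]mx11_scalar b0 raddf0.
split=> [e e0 e_lt | _ [e0 [n1' [n2' [U' [e0_gt e0_lt schurU' lyapU']]]]]].
  have Re_lt0 i : (1 <= i <= m.+1)%N -> complex.Re (lam i + e%:C) < 0.
    case/andP=> i1 im; have := hlam_ord i m.+1 i1 im (leqnn _).
    by case: (lam i) => x y /= ?; lra.
  have lam_e i : (1 <= i <= m.+1)%N -> lam i + e%:C != 0.
    by move/Re_lt0; apply: contraTneq => ->; rewrite ltxx.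
  apply: (feedback1_SNI_with_degree beta0 rho0 e0) => z z_eig.
  have [j ->] := eigenvalue_distinct (Armx_eig_inj hlam_dist lam_e)
    (Armx_eigP hCB hlam_eig hlam_dist hlam_zero lam_e) z_eig.
  rewrite /Armx_eig; case: eqVneq => // jm; apply/ltW/Re_lt0.
  by rewrite /= lt_ord_max.
move=> e e_gt e_lt n1 n2 U schurU.
have n2E' := level_schur_dim hCB hlam_eig hlam_dist hlam_ord hlam_zero e0_gt e0_lt schurU'.
have n2E := level_schur_dim hCB hlam_eig hlam_dist hlam_ord hlam_zero e_gt e_lt schurU.
subst n2 n2'.
split.
  apply/(level_lyapunov_conditions hCB rho0 hlam_eig hlam_dist hlam_ord hlam_zero
    e_gt e_lt schurU).
  have /(level_lyapunov_conditions hCB rho0 hlam_eig hlam_dist hlam_ord hlam_zero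
    e0_gt e0_lt schurU') := lyapU'.
  apply: (lyapunov_form_level hCB rho0 hlam_eig hlam_dist hlam_ord hlam_neg hlam_zero
    _ _ schurU' schurU); exact/andP.
move=> T S; exact: (level_closed_loop hCB rho0 hlam_eig hlam_dist hlam_ord hlam_neg hlam_zero).
Qed.
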